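(* Let $f(x,y,z)$ be an invertible polynomial in three variables, of one of the Types I–V, and let $f^t$ be its Berglund–Hübsch transpose. Let $A_{G_f}$ and $A_{G_{f^t}}$ be the Dolgachev numbers of the pairs $(f,G_f)$ and $(f^t,G_{f^t})$. Then $$\Delta(A_{G_f})=\Delta(A_{G_{f^t}}),$$ where $\Delta(a,b,c):=abc-bc-ac-ab$.
   Context: Write $f=\sum_{i=1}^3\prod_{j=1}^3x_j^{E_{ij}}$ with $(x_1,x_2,x_3)=(x,y,z)$; the Berglund–Hübsch transpose is $f^t=\sum_{i=1}^3\prod_{j=1}^3x_j^{E_{ji}}$. The invertible polynomials in three variables are (up to weighted homogeneous coordinate change): Type I: $f=x^{p_1}+y^{p_2}+z^{p_3}$, $f^t=x^{p_1}+y^{p_2}+z^{p_3}$ ($p_1,p_2,p_3\in\mathbb{Z}_{\ge2}$); Type II: $f=x^{p_1}+y^{p_2}+yz^{p_3/p_2}$, $f^t=x^{p_1}+y^{p_2}z+z^{p_3/p_2}$ ($p_1,p_2,\frac{p_3}{p_2}\in\mathbb{Z}_{\ge2}$); Type III: $f=x^{p_1}+zy^{q_2+1}+yz^{q_3+1}$, $f^t=x^{p_1}+zy^{q_2+1}+yz^{q_3+1}$ ($p_1\in\mathbb{Z}_{\ge2}$, $q_2,q_3\in\mathbb{Z}_{\ge1}$); Type IV: $f=x^{p_1}+xy^{p_2/p_1}+yz^{p_3/p_2}$, $f^t=x^{p_1}y+y^{p_2/p_1}z+z^{p_3/p_2}$ ($p_1,\frac{p_2}{p_1},\frac{p_3}{p_2}\in\mathbb{Z}_{\ge2}$);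 Type V: $f=x^{q_1}y+y^{q_2}z+z^{q_3}x$, $f^t=zx^{q_1}+xy^{q_2}+yz^{q_3}$ ($q_1,q_2,q_3\in\mathbb{Z}_{\ge1}$). After a permutation of the variables, $f^t$ is again of the same type as $f$ with different parameters, so the following definition applies to $f^t$ too. Let $G_f=\{(\lambda_1,\lambda_2,\lambda_3)\in(\mathbb{C}^* )^3:\prod_j\lambda_j^{E_{1j}}=\prod_j\lambda_j^{E_{2j}}=\prod_j\lambda_j^{E_{3j}}\}$. The Dolgachev numbers $A_{G_f}=(\alpha_1,\alpha_2,\alpha_3)$ are the orders of the isotropy groups of the (at most three) isotropic points of the stack $[(f^{-1}(0)\setminus\{0\})/G_f]$ (completed by $1$'s if there are fewer than three). Explicitly: Type I: $(p_1,p_2,p_3)$; Type II: $(p_1,\frac{p_3}{p_2},(p_2-1)p_1)$; Type III: $(p_1,p_1q_2,p_1q_3)$; Type IV: $(\frac{p_3}{p_2},(p_1-1)\frac{p_3}{p_2},p_2-p_1+1)$; Type V: $(q_2q_3-q_3+1,q_3q_1-q_1+1,q_1q_2-q_2+1)$. *)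

(* Defs.v *)
From HB Require Import structures.
From mathcomp Require Import all_boot all_order all_algebra.
From mathcomp Require Import boolp classical_sets cardinality reals.
From mathcomp Require Import complex mpoly.

Set Implicit Arguments.
Unset Strict Implicit.
Unset Printing Implicit Defensive.

Import GRing.Theory.

Local Open Scope classical_set_scope.
Local Open Scope card_scope.
Local Open Scope complex_scope.
Local Open Scope ring_scope.

(** [E] is the exponent matrix: row [i] is the [i]-th monomial, column [j] the
    exponent of the [j]-th variable; the transposed polynomial is that of [E^T]. *)
Definition invertible_poly (R : realType) (E : 'M[nat]_3) : {mpoly R[i][3]} :=
  \sum_(i < 3) \prod_(j < 3) 'X_j ^+ E i j.

Definition exponent_matrix (rows : seq (seq nat)) : 'M[nat]_3 :=
  \matrix_(i < 3, j < 3) nth 0%N (nth [::] rows i) j.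

Local Open Scope nat_scope.

Inductive invertible_type : 'M[nat]_3 -> Prop :=
  (** x^p1 + y^p2 + z^p3 *)
  | TypeI p1 p2 p3 of 2 <= p1 & 2 <= p2 & 2 <= p3 :
      invertible_type (exponent_matrix [:: [:: p1; 0; 0];
                                           [:: 0; p2; 0];
                                           [:: 0; 0; p3]])
  (** x^p1 + y^p2 + y z^(p3/p2) *)
  | TypeII p1 p2 p3 of 2 <= p1 & 2 <= p2 & p2 %| p3 & 2 <= p3 %/ p2 :
      invertible_type (exponent_matrix [:: [:: p1; 0; 0];
                                           [:: 0; p2; 0];
                                           [:: 0; 1; p3 %/ p2]])
  (** x^p1 + z y^(q2+1) + y z^(q3+1) *)
  | TypeIII p1 q2 q3 of 2 <= p1 & 1 <= q2 & 1 <= q3 :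
      invertible_type (exponent_matrix [:: [:: p1; 0; 0];
                                           [:: 0; q2.+1; 1];
                                           [:: 0; 1; q3.+1]])
  (** x^p1 + x y^(p2/p1) + y z^(p3/p2) *)
  | TypeIV p1 p2 p3 of 2 <= p1 & p1 %| p2 & 2 <= p2 %/ p1
                     & p2 %| p3 & 2 <= p3 %/ p2 :
      invertible_type (exponent_matrix [:: [:: p1; 0; 0];
                                           [:: 1; p2 %/ p1; 0];
                                           [:: 0; 1; p3 %/ p2]])
  (** x^q1 y + y^q2 z + z^q3 x *)
  | TypeV q1 q2 q3 of 1 <= q1 & 1 <= q2 & 1 <= q3 :
      invertible_type (exponent_matrix [:: [:: q1; 1; 0];
                                           [:: 0; q2; 1];
                                           [:: 1; 0; q3]]).

Local Open Scope ring_scope.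

(** Elements of the torus and points of affine 3-space are row vectors. *)
Definition max_group (R : realType) (E : 'M[nat]_3) : set 'rV[R[i]]_3 :=
  [set l | (forall j, l 0 j != 0) /\
           forall i k, \prod_(j < 3) l 0 j ^+ E i j =
                       \prod_(j < 3) l 0 j ^+ E k j].

Definition torus_act (R : realType) (l x : 'rV[R[i]]_3) : 'rV[R[i]]_3 :=
  \row_j (l 0 j * x 0 j).

Definition punctured_zeros (R : realType) (E : 'M[nat]_3) : set 'rV[R[i]]_3 :=
  [set x : 'rV_3 | x != 0 /\ (invertible_poly R E).@[x 0] = 0].

Definition group_orbit (R : realType) (E : 'M[nat]_3) (x : 'rV[R[i]]_3) :
    set 'rV[R[i]]_3 :=
  [set torus_act l x | l in @max_group R E].

Definition isotropy_group (R : realType) (E : 'M[nat]_3) (x : 'rV[R[i]]_3) :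
    set 'rV[R[i]]_3 :=
  [set l | max_group E l /\ torus_act l x = x].

Definition isotropic (R : realType) (E : 'M[nat]_3) (x : 'rV[R[i]]_3) : Prop :=
  punctured_zeros E x /\ isotropy_group E x <> [set const_mx 1].

(** [A] lists, in some order, the orders of the isotropy groups of the isotropic
    points of the quotient stack, completed by 1's. A point of the stack is a
    [max_group]-orbit; [s] pairs a representative of each isotropic one with the
    order of its isotropy group. As [A] has size 3, [perm_eq] also bounds the
    number of isotropic points by 3. *)
Definition dolgachev_numbers (R : realType) (E : 'M[nat]_3)
    (A : 3.-tuple nat) : Prop :=
  exists s : seq ('rV[R[i]]_3 * nat),
    [/\ forall p, p \in s ->
          isotropic E p.1 /\ isotropy_group E p.1 #= `I_(p.2),
        uniq [seq group_orbit E p.1 | p <- s],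
        forall x : 'rV[R[i]]_3, isotropic E x ->
          group_orbit E x \in [seq group_orbit E p.1 | p <- s]
      & perm_eq A ([seq p.2 | p <- s] ++ nseq (3 - size s) 1%N)].

Definition Delta (A : 3.-tuple nat) : int :=
  let a := (tnth A 0)%:Z in
  let b := (tnth A 1)%:Z in
  let c := (tnth A 2%:R)%:Z in
  a * b * c - b * c - a * c - a * b.

(* Main.v *)
Require Import Defs.
From mathcomp Require Import all_boot all_order all_algebra.
From mathcomp Require Import reals.
From mathcomp Require Import all_fingroup all_field.
From mathcomp Require Import boolp classical_sets functions cardinality.
From mathcomp Require Import complex mpoly ring.

Set Implicit Arguments.
Unset Strict Implicit.
Unset Printing Implicit Defensive.

Import GRing.Theory Num.Theory.
(** The Dolgachev numbers of each normal form can be read off from an explicit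
    list of three points, after which the equality is a polynomial identity in
    the exponents.

    A torus element fixes a point exactly when its coordinates are 1 wherever
    those of the point are nonzero. Hence a zero of f with nontrivial isotropy
    lies on a coordinate plane, where f has at most two monomials left. In each
    of the five types exactly three sets of vanishing coordinates are possible
    for a zero on a coordinate plane; orbits preserve this set, and all the
    zeros with a given one form a single orbit, because the scalars carrying one
    to another solve binomial equations, hence can be extracted as complex
    roots. This gives
    three pairwise distinct orbits with representatives having coordinates 0, 1
    or a root of -1. Their isotropy groups are cyclic: the defining equations
    leave one free coordinate t with t ^+ n = 1, the others being powers of t,
    and there are n such t in a closed field of characteristic 0. A
    representative may turn out to have trivial isotropy (this can happen in
    type V); it is then not isotropic, but the completion by 1's restores its
    entry, so the criterion [dolgachev_numbers_of_points] covers it too.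

    The transpose of a normal form is, after a permutation of the variables, a
    normal form of the same type, and [dolgachev_numbers_perm] carries the list
    over. Since a list of Dolgachev numbers is determined up to order
    ([dolgachev_numbers_uniq]) and Delta is symmetric ([Delta_perm]), it remains
    to compare Delta on the two explicit triples. *)

Local Open Scope classical_set_scope.
Local Open Scope card_scope.
Local Open Scope complex_scope.
Local Open Scope ring_scope.

(** * Roots in a closed field of characteristic 0 *)

Lemma card_unity_roots (F : numClosedFieldType) (n : nat) :
  (0 < n)%N -> [set t : F | t ^+ n = 1] #= `I_n.
Proof.
move=> n_gt0; have [r Dp] := closed_field_poly_normal ('X^n - 1 : {poly F}).
move: Dp; rewrite (monicP _) ?monicXnsubC ?scale1r // => Dp.
have Ur : uniq r.
  by rewrite -separable_prod_XsubC -Dp separable_Xn_sub_1 // pnatr_eq0 -lt0n.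
have Sr : size r = n.
  by apply/succn_inj; rewrite -(size_prod_XsubC r id) -Dp size_XnsubC.
have mem_r t : (t \in r) = (t ^+ n == 1).
  by rewrite -root_prod_XsubC -Dp /root !hornerE subr_eq0.
have memE t : [set t : F | t ^+ n = 1] t -> t \in r.
  by move=> /= tn; rewrite mem_r tn.
apply/card_set_bijP; exists (index^~ r); split.
- by move=> t /memE rt /=; rewrite -Sr index_mem.
- move=> t u /set_mem/memE rt /set_mem/memE ru eq_tu.
  by rewrite -(nth_index 0 rt) eq_tu nth_index.
move=> i /= lt_i_n; exists (nth 0 r i); last by rewrite index_uniq ?Sr.
by apply/eqP; rewrite -mem_r mem_nth ?Sr.
Qed.

Lemma exists_root (F : numClosedFieldType) (n : nat) (a : F) :
  (0 < n)%N -> a != 0 -> exists2 b, b != 0 & b ^+ n = a.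
Proof.
move=> n_gt0 a0; exists (n.-root a); last exact: rootCK.
by rewrite rootC_eq0.
Qed.

Lemma unity_root_neq0 (F : fieldType) (n : nat) (t : F) :
  t ^+ n.+1 = 1 -> t != 0.
Proof. by apply: contra_eqN => /eqP->; rewrite expr0n eq_sym oner_eq0. Qed.

(** * The torus action and its isotropy groups *)

Section Action.
Variables (R : realType) (E : 'M[nat]_3).
Notation V := 'rV[R[i]]_3.
Implicit Types l m x y : V.

Lemma torus_act1 x : torus_act (const_mx 1) x = x.
Proof. by apply/rowP=> j; rewrite !mxE mul1r. Qed.

Lemma torus_actM l m x :
  torus_act l (torus_act m x) = torus_act (torus_act l m) x.
Proof. by apply/rowP=> j; rewrite !mxE mulrA. Qed.

Lemma torus_actC l m : torus_act l m = torus_act m l.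
Proof. by apply/rowP=> j; rewrite !mxE mulrC. Qed.

Lemma max_group1 : max_group E (const_mx 1 : V).
Proof.
split=> [j|i k]; first by rewrite mxE oner_eq0.
by rewrite !big1 // => j _; rewrite mxE expr1n.
Qed.

Lemma max_groupM l m :
  max_group E l -> max_group E m -> max_group E (torus_act l m).
Proof.
case=> l0 lE [m0 mE]; split=> [j|i k]; first by rewrite mxE mulf_neq0.
have split_prod i' : \prod_(j < 3) torus_act l m 0 j ^+ E i' j =
    \prod_(j < 3) l 0 j ^+ E i' j * \prod_(j < 3) m 0 j ^+ E i' j.
  by rewrite -big_split; apply: eq_bigr => j _; rewrite mxE exprMn.
by rewrite !split_prod (lE i k) (mE i k).
Qed.

Lemma max_groupV l : max_group E l ->
  exists2 m, max_group E m & torus_act m l = const_mx 1.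
Proof.
case=> l0 lE; exists (\row_j (l 0 j)^-1).
  split=> [j|i k]; first by rewrite mxE invr_eq0.
  have inv_prod i' : \prod_(j < 3) (\row_j (l 0 j)^-1 : V) 0 j ^+ E i' j =
      (\prod_(j < 3) l 0 j ^+ E i' j)^-1.
    by rewrite -prodfV; apply: eq_bigr => j _; rewrite mxE exprVn.
  by rewrite !inv_prod (lE i k).
by apply/rowP=> j; rewrite !mxE mulVf.
Qed.

Lemma group_orbit_refl x : group_orbit E x x.
Proof. by exists (const_mx 1); [exact: max_group1 | rewrite torus_act1]. Qed.

Lemma group_orbit_sub x y :
  group_orbit E x y -> group_orbit E y `<=` group_orbit E x.
Proof.
move=> [l El <-] _ [m Em <-]; exists (torus_act m l); first exact: max_groupM.
by rewrite torus_actM.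
Qed.

Lemma group_orbit_eq x y :
  group_orbit E x y -> group_orbit E y = group_orbit E x.
Proof.
move=> xy; apply/seteqP; split; first exact: group_orbit_sub.
apply: group_orbit_sub; case: xy => l El <-; have [m Em ml] := max_groupV El.
by exists m => //; rewrite torus_actM ml torus_act1.
Qed.

(** The torus is commutative, so conjugate isotropy groups coincide. *)
Lemma isotropy_group_orbit x y :
  group_orbit E x y -> isotropy_group E y = isotropy_group E x.
Proof.
case=> l [l0 _] <-; apply/seteqP; split=> m [Em mx]; split=> //; last first.
  by rewrite torus_actM [torus_act m l]torus_actC -torus_actM mx.
apply/rowP=> j; move/rowP/(_ j): mx; rewrite !mxE => mx.
by apply: (mulfI (l0 j)); rewrite -[RHS]mx mulrCA.
Qed.

Lemma isotropy_group_free x :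
  (forall j, x 0 j != 0) -> isotropy_group E x = [set const_mx 1].
Proof.
move=> x0; apply/seteqP; split=> [l [_ /rowP lx]|_ ->]; last first.
  by split; [exact: max_group1 | exact: torus_act1].
apply/rowP=> j; rewrite mxE; move/(_ j): lx; rewrite mxE => lx.
by apply: (mulIf (x0 j)); rewrite lx mul1r.
Qed.

Lemma isotropy_order_eq1 x n : isotropy_group E x #= `I_n ->
  (n == 1%N) = `[< isotropy_group E x = [set const_mx 1] >].
Proof.
move=> card_x; apply/eqP/asboolP=> [n1|iso_x].
  move: card_x; rewrite n1 => /card_set_bijP[f [f_lt1 f_inj _]].
  have iso1 : isotropy_group E x (const_mx 1).
    by split; [exact: max_group1 | exact: torus_act1].
  apply/seteqP; split=> [l xl|_ -> //].
  apply: f_inj; rewrite ?inE //.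
  by move: (f_lt1 _ xl) (f_lt1 _ iso1) => /=; rewrite !ltnS !leqn0 => /eqP-> /eqP->.
apply/card_eq_II; apply: card_eq_trans (card_esym card_x) _.
by rewrite iso_x; exact: card_set1.
Qed.

(** Two lists of representatives enumerate the same orbits, and the isotropy
    order depends on the orbit only: the sets of pairs (orbit, order) agree. *)
Lemma dolgachev_numbers_uniq (A B : 3.-tuple nat) :
  dolgachev_numbers R E A -> dolgachev_numbers R E B -> perm_eq A B.
Proof.
case=> s [s_iso s_uniq s_all As] [s' [s'_iso s'_uniq s'_all Bs']].
pose orb (p : V * nat) := (group_orbit E p.1, p.2).
have orb_uniq (r : seq (V * nat)) :
  uniq [seq group_orbit E p.1 | p <- r] -> uniq (map orb r).
  by move=> Ur; apply: (@map_uniq _ _ fst); rewrite -map_comp.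
have orb_sub (r r' : seq (V * nat)) :
    (forall p, p \in r -> isotropic E p.1 /\ isotropy_group E p.1 #= `I_(p.2)) ->
    (forall p, p \in r' -> isotropic E p.1 /\ isotropy_group E p.1 #= `I_(p.2)) ->
    (forall x : V, isotropic E x ->
       group_orbit E x \in [seq group_orbit E p.1 | p <- r']) ->
    {subset map orb r <= map orb r'}.
  move=> r_iso r'_iso r'_all _ /mapP[p rp ->].
  have [p_iso p_card] := r_iso p rp.
  have /mapP[q r'q pq] := r'_all _ p_iso; have [_ q_card] := r'_iso q r'q.
  suff -> : orb p = orb q by exact: map_f.
  have qp : group_orbit E q.1 p.1 by rewrite -pq; exact: group_orbit_refl.
  rewrite /orb pq; congr (_, _); apply/card_eq_II.
  apply: card_eq_trans (card_esym p_card) _.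
  by rewrite (isotropy_group_orbit qp).
have orb_ss' : perm_eq (map orb s) (map orb s').
  apply: uniq_perm; [exact: orb_uniq | exact: orb_uniq |].
  by move=> o; apply/idP/idP; apply: orb_sub.
have ss' : perm_eq [seq p.2 | p <- s] [seq p.2 | p <- s'].
  by move: (perm_map snd orb_ss'); rewrite -!map_comp.
rewrite (perm_trans As) // perm_sym (perm_trans Bs') // perm_sym.
have /eqP := perm_size ss'; rewrite !size_map => /eqP ->.
by rewrite perm_cat2r.
Qed.

(** An invariant of the orbits, since torus elements have nonzero coordinates;
    it is enough to separate the three orbits of every type. *)
Definition vanishing x : seq bool := [seq x 0 j == 0 | j <- enum 'I_3].

Lemma vanishing_orbit x y : group_orbit E x y -> vanishing y = vanishing x.
Proof.
case=> l [l0 _] <-; apply: eq_map => j.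
by rewrite mxE mulf_eq0 (negPf (l0 j)).
Qed.

(** The orders are allowed to be 1: such points are filtered out of the list of
    isotropic points, and each leaves behind one of the 1's of the completion. *)
Lemma dolgachev_numbers_of_points (s : 3.-tuple (V * nat)) :
  (forall p, p \in s ->
     punctured_zeros E p.1 /\ isotropy_group E p.1 #= `I_(p.2)) ->
  uniq [seq vanishing p.1 | p <- s] ->
  (forall x : V, punctured_zeros E x -> [exists j, x 0 j == 0] ->
     exists2 p, p \in s & group_orbit E p.1 x) ->
  dolgachev_numbers R E [tuple of map snd s].
Proof.
move=> s_zero s_uniq s_cover.
exists [seq p <- s | p.2 != 1%N]; split.
- move=> p; rewrite mem_filter => /andP[p1 sp].
  have [p_zero p_card] := s_zero p sp; split=> //; split=> //.
  by move: p1; rewrite (isotropy_order_eq1 p_card) => /asboolPn.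
  (* [xget 0] picks a point of an orbit, on which [vanishing] is constant. *)
- apply: (@map_uniq _ _ (vanishing \o xget 0)).
  rewrite -map_comp (eq_map (g := fun p => vanishing p.1)) => [|p /=].
    exact: subseq_uniq (map_subseq _ (filter_subseq _ s)) s_uniq.
  by apply: vanishing_orbit; apply: xgetI (group_orbit_refl p.1).
- move=> x [x_zero x_iso].
  have x0 : [exists j, x 0 j == 0].
    apply: contra_notT x_iso => /existsPn; exact: isotropy_group_free.
  have [p sp px] := s_cover x x_zero x0.
  rewrite (group_orbit_eq px); apply/mapP; exists p => //.
  rewrite mem_filter sp andbT.
  have [_ p_card] := s_zero p sp.
  by rewrite (isotropy_order_eq1 p_card) -(isotropy_group_orbit px); apply/asboolPn.
set a := fun p : V * nat => p.2 != 1%N.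
have /all_pred1P ones : all (pred1 1%N)
    [seq p.2 | p : V * nat <- s & predC a p].
  apply/allP=> k /mapP[p]; rewrite mem_filter /= negbK => /andP[/eqP p1 _] ->.
  exact/eqP.
have size_a : (3 - size (filter a s))%N = size (filter (predC a) s).
  by rewrite !size_filter; apply: (canLR (addKn _)); rewrite count_predC size_tuple.
rewrite size_a -(size_map snd) -ones -map_cat perm_sym.
exact/perm_map/permPl/perm_filterC.
Qed.

Lemma meval_invertible_poly x :
  (invertible_poly R E).@[x 0] = \sum_(i < 3) \prod_(j < 3) x 0 j ^+ E i j.
Proof.
rewrite rmorph_sum; apply: eq_bigr => i _ /=; rewrite rmorph_prod.
by apply: eq_bigr => j _; rewrite rmorphXn /= mevalXU.
Qed.

End Action.

Section Hyperplane.
Variable R : realType.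

(** When x_j is the only vanishing coordinate, an isotropy element is determined
    by its j-th coordinate t. As x_j occurs in one monomial only, the monomials
    evaluate to t ^+ n.+1 and, for the two others, to 1. *)
Lemma card_isotropy_hyperplane (E : 'M[nat]_3) (x : 'rV[R[i]]_3) (i0 j : 'I_3)
    (n : nat) :
  (forall i, E i j = if i == i0 then n.+1 else 0%N) ->
  (forall k, (x 0 k == 0) = (k == j)) ->
  isotropy_group E x #= `I_n.+1.
Proof.
move=> Ej xj; pose f (t : R[i]) : 'rV[R[i]]_3 := \row_k (if k == j then t else 1).
have monomial_f t i : \prod_(k < 3) f t 0 k ^+ E i k = if i == i0 then t ^+ n.+1 else 1.
  rewrite (bigD1 j) //= big1 => [|k k_j]; last by rewrite mxE (negPf k_j) expr1n.
  by rewrite mxE eqxx Ej mulr1; case: ifP.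
have -> : isotropy_group E x = f @` [set t : R[i] | t ^+ n.+1 = 1].
  apply/seteqP; split=> [l [[_ lE] lx]|_ [t tn <-]].
    have l_f : l = f (l 0 j).
      apply/rowP=> k; rewrite mxE; case: (eqVneq k j) => [->//|]; rewrite -xj => xk.
      by apply: (mulIf xk); move/rowP/(_ k): lx; rewrite mxE mul1r.
    (* any row other than [i0] would do in place of [i0 + 1] *)
    exists (l 0 j) => //=; move: (lE i0 (i0 + 1)); rewrite l_f !monomial_f eqxx.
    by rewrite mxE eqxx; case: eqP => // /(canRL (addKr _)); rewrite addNr => /eqP.
  split; last first.
    apply/rowP=> k; rewrite !mxE; case: (eqVneq k j) => [->|_]; last exact: mul1r.
    by have /eqP-> : x 0 j == 0; rewrite ?xj ?mulr0.
  split=> [k|i k]; last by rewrite !monomial_f /= tn !if_same.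
  by rewrite mxE; case: ifP => _; rewrite ?oner_eq0 // (unity_root_neq0 tn).
apply: card_eq_trans (card_unity_roots _ (ltn0Sn n)).
by apply: inj_card_eq => t u _ _ /rowP/(_ j); rewrite !mxE eqxx.
Qed.

End Hyperplane.

(** * Permuting the variables and the monomials *)

Section Permutation.
Variables (R : realType) (E : 'M[nat]_3) (s t : 'S_3).
Notation V := 'rV[R[i]]_3.
Let E' := row_perm s (col_perm t E).
Implicit Types l x : V.

Lemma prod_perm x i :
  \prod_(j < 3) col_perm t x 0 j ^+ E' i j = \prod_(j < 3) x 0 j ^+ E (s i) j.
Proof.
by rewrite [RHS](reindex_inj (@perm_inj _ t)); apply: eq_bigr => j _; rewrite !mxE.
Qed.

Lemma max_group_perm l : max_group E' (col_perm t l) <-> max_group E l.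
Proof.
split=> -[l0 lE]; split=> [j|i k].
- by have := l0 ((t^-1)%g j); rewrite mxE permKV.
- by have := lE ((s^-1)%g i) ((s^-1)%g k); rewrite !prod_perm !permKV.
- by rewrite mxE.
- by rewrite !prod_perm.
Qed.

Lemma punctured_zeros_perm x :
  punctured_zeros E' (col_perm t x) <-> punctured_zeros E x.
Proof.
rewrite /punctured_zeros /= !meval_invertible_poly.
under eq_bigr do rewrite prod_perm.
rewrite -(reindex_inj (@perm_inj _ s) (P := xpredT)
  (F := fun i => \prod_(j < 3) x 0 j ^+ E i j)).
have col_perm_eq0 : (col_perm t x == 0) = (x == 0).
  apply/eqP/eqP=> [/rowP x0|->]; last by rewrite raddf0.
  by apply/rowP=> j; have := x0 ((t^-1)%g j); rewrite !mxE permKV.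
by rewrite col_perm_eq0.
Qed.

Lemma torus_act_perm l x :
  torus_act (col_perm t l) (col_perm t x) = col_perm t (torus_act l x).
Proof. by apply/rowP=> j; rewrite !mxE. Qed.

Lemma col_permVK : cancel (@col_perm R[i] 1 3 t^-1) (col_perm t).
Proof. by move=> x; rewrite -col_permM mulgV col_perm1. Qed.

Lemma col_permKV : cancel (@col_perm R[i] 1 3 t) (col_perm t^-1).
Proof. by move=> x; rewrite -col_permM mulVg col_perm1. Qed.

Lemma image_col_perm_inj :
  injective (fun A : set V => col_perm t @` A).
Proof.
apply: (can_inj (g := fun A : set V => col_perm t^-1 @` A)) => A.
rewrite image_comp -[RHS]image_id; apply: eq_imagel => x _; exact: col_permKV.
Qed.

Lemma group_orbit_perm x :
  group_orbit E' (col_perm t x) = col_perm t @` group_orbit E x.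
Proof.
apply/seteqP; split=> [_ [l El <-]|_ [_ [l El <-] <-]].
  rewrite -[l]col_permVK torus_act_perm; exists (torus_act (col_perm t^-1 l) x) => //.
  by exists (col_perm t^-1 l) => //; apply/max_group_perm; rewrite col_permVK.
by rewrite -torus_act_perm; exists (col_perm t l) => //; apply/max_group_perm.
Qed.

Lemma isotropy_group_perm x :
  isotropy_group E' (col_perm t x) = col_perm t @` isotropy_group E x.
Proof.
apply/seteqP; split=> [l [El lx]|_ [l [El lx] <-]].
  exists (col_perm t^-1 l); last by rewrite col_permVK.
  split; first by apply/max_group_perm; rewrite col_permVK.
  by apply: (can_inj col_permKV); rewrite -torus_act_perm col_permVK.
by split; [exact/max_group_perm | rewrite torus_act_perm lx].
Qed.

Lemma isotropic_perm x : isotropic E' (col_perm t x) <-> isotropic E x.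
Proof.
have act1 : [set const_mx 1] = col_perm t @` [set const_mx 1 : V].
  by rewrite image_set1 col_perm_const.
rewrite /isotropic isotropy_group_perm.
split=> -[x_zero x_iso]; split; try exact/punctured_zeros_perm.
  by move=> iso1; apply: x_iso; rewrite iso1 -act1.
by rewrite act1; move/image_col_perm_inj.
Qed.

Lemma dolgachev_numbers_perm (A : 3.-tuple nat) :
  dolgachev_numbers R E A -> dolgachev_numbers R E' A.
Proof.
case=> r [r_iso r_uniq r_all Ar].
pose pi (p : V * nat) := (col_perm t p.1, p.2).
have orb_pi : [seq group_orbit E' p.1 | p <- map pi r] =
    map (image ^~ (col_perm t)) [seq group_orbit E p.1 | p <- r].
  by rewrite -!map_comp; apply: eq_map => p /=; rewrite group_orbit_perm.
exists (map pi r); split.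
- move=> _ /mapP[p rp ->]; have [p_iso p_card] := r_iso p rp.
  split; first exact/isotropic_perm.
  rewrite /= isotropy_group_perm; apply: card_eq_trans p_card.
  by apply: inj_card_eq => l m _ _ /(can_inj col_permKV).
- rewrite orb_pi map_inj_uniq //; exact: image_col_perm_inj.
- move=> x; rewrite -[x]col_permVK => /isotropic_perm/r_all x_all.
  by rewrite orb_pi group_orbit_perm; exact: (map_f (image ^~ (col_perm t))).
by rewrite size_map -map_comp.
Qed.
End Permutation.

(** * Points in coordinates *)

Section Coordinates.
Variables (R : realType).
Local Notation C := R[i].

Definition point3 (x y z : C) : 'rV[C]_3 := \row_j [:: x; y; z]`_j.

Lemma row3E (v : 'rV[C]_3) : exists x y z, v = point3 x y z.
Proof.
exists (v 0 0), (v 0 1), (v 0 2%:R); apply/rowP=> -[[|[|[|k]]] lt_k3] //=;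
  by rewrite mxE; congr (v _ _); apply: val_inj.
Qed.

Lemma point3_inj x y z x' y' z' :
  point3 x y z = point3 x' y' z' <-> [/\ x = x', y = y' & z = z'].
Proof.
split=> [/rowP eq_p|[-> -> -> //]].
by split; [have := eq_p 0 | have := eq_p 1 | have := eq_p 2%:R]; rewrite !mxE.
Qed.

Lemma torus_act3 a b c x y z :
  torus_act (point3 a b c) (point3 x y z) = point3 (a * x) (b * y) (c * z).
Proof. by apply/rowP=> -[[|[|[|k]]] lt_k3] //=; rewrite !mxE. Qed.

Lemma vanishing3 x y z : vanishing (point3 x y z) = [:: x == 0; y == 0; z == 0].
Proof. by rewrite /vanishing !enum_ordSl /= (size0nil (size_enum_ord 0)) /= !mxE. Qed.

Variables a1 a2 a3 b1 b2 b3 c1 c2 c3 : nat.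
Let E := exponent_matrix [:: [:: a1; a2; a3]; [:: b1; b2; b3]; [:: c1; c2; c3]].

Lemma max_group3 x y z : max_group E (point3 x y z) <->
  [/\ x != 0, y != 0, z != 0,
      x ^+ a1 * y ^+ a2 * z ^+ a3 = x ^+ b1 * y ^+ b2 * z ^+ b3 &
      x ^+ b1 * y ^+ b2 * z ^+ b3 = x ^+ c1 * y ^+ c2 * z ^+ c3].
Proof.
have prodE i : \prod_(j < 3) point3 x y z 0 j ^+ E i j =
    x ^+ E i 0 * y ^+ E i 1 * z ^+ E i 2%:R.
  by rewrite !big_ord_recl big_ord0 mulr1 mulrA !mxE.
split=> [[nz eqE]|[x0 y0 z0 eq_ab eq_bc]].
  have:= (eqE 0 1, eqE 1 2%:R, nz 0, nz 1, nz 2%:R).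
  by rewrite !prodE !mxE /= => -[[[[? ?] ?] ?] ?].
split=> [[[|[|[|j]]] lt_j3]|] //=; rewrite ?mxE //.
move=> [[|[|[|i]]] lt_i3] [[|[|[|k]]] lt_k3] //;
  by rewrite !prodE !mxE /= ?eq_ab ?eq_bc.
Qed.

Lemma punctured_zeros3 x y z : punctured_zeros E (point3 x y z) <->
  ~~ [&& x == 0, y == 0 & z == 0] /\
  x ^+ a1 * y ^+ a2 * z ^+ a3 + x ^+ b1 * y ^+ b2 * z ^+ b3 +
  x ^+ c1 * y ^+ c2 * z ^+ c3 = 0.
Proof.
rewrite /punctured_zeros /= meval_invertible_poly !big_ord_recl !big_ord0.
rewrite !mxE /= !mulr1 addr0 !mulrA addrA.
have -> // : (point3 x y z == 0) = [&& x == 0, y == 0 & z == 0].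
have -> : 0 = point3 0 0 0 by apply/rowP=> -[[|[|[|k]]] lt_k3] //=; rewrite !mxE.
by apply/eqP/and3P=> [/point3_inj[-> -> ->] //|[/eqP-> /eqP-> /eqP->]].
Qed.

Lemma group_orbit3 l m n x y z x' y' z' : max_group E (point3 l m n) ->
  l * x = x' -> m * y = y' -> n * z = z' ->
  group_orbit E (point3 x y z) (point3 x' y' z').
Proof. by move=> El <- <- <-; exists (point3 l m n); rewrite ?torus_act3. Qed.

Lemma isotropy_group3 l m n x y z :
  isotropy_group E (point3 x y z) (point3 l m n) <->
  max_group E (point3 l m n) /\ [/\ l * x = x, m * y = y & n * z = z].
Proof. by rewrite /isotropy_group /= torus_act3 point3_inj. Qed.

(** A parametrization by powers of t is injective on the roots of unity as soon
    as one of the exponents is 1. *)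
Lemma card_isotropy_cyclic (x : 'rV[C]_3) (k1 k2 k3 n : nat) :
  (0 < n)%N -> 1%N \in [:: k1; k2; k3] ->
  (forall l1 l2 l3, isotropy_group E x (point3 l1 l2 l3) <->
     exists2 t, t ^+ n = 1 & [/\ l1 = t ^+ k1, l2 = t ^+ k2 & l3 = t ^+ k3]) ->
  isotropy_group E x #= `I_n.
Proof.
move=> n_gt0 k_1 xE.
pose f t := point3 (t ^+ k1) (t ^+ k2) (t ^+ k3).
have -> : isotropy_group E x = f @` [set t : C | t ^+ n = 1].
  apply/seteqP; split=> [l|_ [t tn <-]]; last by apply/xE; exists t.
  have [l1 [l2 [l3 ->]]] := row3E l.
  by move=> /xE[t tn [-> -> ->]]; exists t.
apply: card_eq_trans (card_unity_roots C n_gt0).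
apply: inj_card_eq => t u _ _ /point3_inj[].
by move: k_1; rewrite !inE => /or3P[] /eqP <-; rewrite !expr1.
Qed.

Lemma dolgachev_numbers3 (P1 P2 P3 : 'rV[C]_3) (n1 n2 n3 : nat) :
  [/\ punctured_zeros E P1, punctured_zeros E P2 & punctured_zeros E P3] ->
  uniq [:: vanishing P1; vanishing P2; vanishing P3] ->
  [/\ isotropy_group E P1 #= `I_n1, isotropy_group E P2 #= `I_n2 &
      isotropy_group E P3 #= `I_n3] ->
  (forall x y z, [|| x == 0, y == 0 | z == 0] ->
     punctured_zeros E (point3 x y z) ->
     [\/ group_orbit E P1 (point3 x y z), group_orbit E P2 (point3 x y z) |
         group_orbit E P3 (point3 x y z)]) ->
  dolgachev_numbers R E [tuple n1; n2; n3].
Proof.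
move=> [z1 z2 z3] P_uniq [c1' c2' c3'] P_cover.
have -> : [tuple n1; n2; n3] =
    [tuple of map snd [tuple (P1, n1); (P2, n2); (P3, n3)]] by exact: val_inj.
apply: dolgachev_numbers_of_points => // [p|v].
  by rewrite !inE => /or3P[] /eqP ->.
have [x [y [z ->]]] := row3E v => xyz_zero /existsP[j xyz0].
have {xyz0} : [|| x == 0, y == 0 | z == 0].
  by case: j xyz0 => -[|[|[|j]]] lt_j3 //; rewrite mxE /= => ->; rewrite ?orbT.
case/P_cover/(_ xyz_zero) => vP;
  [exists (P1, n1) | exists (P2, n2) | exists (P3, n3)] => //;
  by rewrite !inE eqxx ?orbT.
Qed.

End Coordinates.

(** * The five types *)

Section Types.
Variable R : realType.
Local Notation C := R[i].
Implicit Types x y z : C.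

(** Evaluates the monomials in which a variable is absent, has exponent 1, or is
    set to 0 or 1. *)
Definition simp3 :=
  (expr0, expr1, expr1n, expr0n, mulr1, mul1r, mulr0, mul0r, addr0, add0r).

Lemma exists_root_opp1 n : exists2 v : C, v != 0 & v ^+ n.+1 = -1.
Proof. by apply: exists_root; rewrite // oppr_eq0 oner_eq0. Qed.

(** The zeros of a binomial off the origin form one orbit under the scalings that
    multiply its two monomials by the same factor: (y, z / v) carries the zero
    (1, v) to the zero (y, z). *)
Lemma binomial_zero p q v y z : v ^+ q.+1 = -1 -> ~~ ((y == 0) && (z == 0)) ->
  y ^+ p.+1 + z ^+ q.+1 = 0 -> [/\ y != 0, z / v != 0 & y ^+ p.+1 = (z / v) ^+ q.+1].
Proof.
move=> vE yz0 /eqP yz.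
have v0 : v != 0.
  by move/eqP: vE; apply: contraTneq => ->; rewrite expr0n eq_sym oppr_eq0 oner_eq0.
have y0 : y != 0.
  apply: contraNneq yz0 => y0; rewrite y0 eqxx.
  by move: yz; rewrite y0 expr0n add0r expf_eq0.
have z0 : z != 0.
  apply: contraNneq yz0 => z0; rewrite z0 eqxx andbT.
  by move: yz; rewrite z0 expr0n addr0 expf_eq0.
split=> //; first by rewrite mulf_neq0 ?invr_eq0.
by rewrite exprMn exprVn vE invrN1 mulrN1; apply/eqP; rewrite -addr_eq0.
Qed.

(** In this and the next lemmas the exponents are written as successors of the
    parameters so that the Dolgachev numbers involve no subtraction. *)
Lemma dolgachev_typeI p1 p2 p3 :
  dolgachev_numbers R
    (exponent_matrix [:: [:: p1.+1; 0; 0]; [:: 0; p2.+1; 0]; [:: 0; 0; p3.+1]])%N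
    [tuple p1.+1; p2.+1; p3.+1].
Proof.
have [v2 v2_neq0 v2E] := exists_root_opp1 p2.
have [v3 v3_neq0 v3E] := exists_root_opp1 p3.
apply: (dolgachev_numbers3 (P1 := point3 0 1 v3) (P2 := point3 1 0 v3)
                           (P3 := point3 1 v2 0)).
- by split; apply/punctured_zeros3; rewrite !simp3 ?v2E ?v3E subrr oner_eq0 ?andbF.
- by rewrite !vanishing3 eqxx oner_eq0 (negPf v2_neq0) (negPf v3_neq0).
- split; [apply: (card_isotropy_hyperplane (i0 := 0) (j := 0)) |
          apply: (card_isotropy_hyperplane (i0 := 1) (j := 1)) |
          apply: (card_isotropy_hyperplane (i0 := 2%:R) (j := 2%:R))]
    => -[[|[|[|k]]] lt_k3] //;
    by rewrite mxE ?eqxx ?oner_eq0 ?(negPf v2_neq0) ?(negPf v3_neq0).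
move=> x y z; case: (eqVneq x 0) => [-> _ | x0].
  case/punctured_zeros3; rewrite eqxx !simp3 => yz0.
  case/(binomial_zero v3E yz0) => y0 z0 yz.
  have [l l0 lE] := exists_root (n := p1.+1) isT (expf_neq0 p2.+1 y0).
  constructor 1; apply: (group_orbit3 (l := l) (m := y) (n := z / v3)).
  - by apply/max_group3; rewrite !simp3.
  - by rewrite mulr0.
  - by rewrite mulr1.
  - by rewrite divfK.
case: (eqVneq y 0) => [-> _ | y0] /=.
  case/punctured_zeros3; rewrite !simp3 eqxx /= => xz0.
  case/(binomial_zero v3E xz0) => _ z0 xz.
  have [l l0 lE] := exists_root (n := p2.+1) isT (expf_neq0 p1.+1 x0).
  constructor 2; apply: (group_orbit3 (l := x) (m := l) (n := z / v3)).
  - by apply/max_group3; rewrite !simp3 lE.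
  - by rewrite mulr1.
  - by rewrite mulr0.
  - by rewrite divfK.
move=> /eqP->; case/punctured_zeros3; rewrite !simp3 eqxx andbT => xy0.
case/(binomial_zero v2E xy0) => _ y1 xy.
have [l l0 lE] := exists_root (n := p3.+1) isT (expf_neq0 p1.+1 x0).
constructor 3; apply: (group_orbit3 (l := x) (m := y / v2) (n := l)).
- by apply/max_group3; rewrite !simp3 -xy lE.
- by rewrite mulr1.
- by rewrite divfK.
- by rewrite mulr0.
Qed.

(** On the plane x = 0 the polynomial is y (y^(p2+1) + z^(r+1)), whose factors give
    the point of the z-axis and the orbit off the axes. *)
Lemma dolgachev_typeII p1 p2 r :
  dolgachev_numbers R
    (exponent_matrix [:: [:: p1.+1; 0; 0]; [:: 0; p2.+2; 0]; [:: 0; 1; r.+1]])%N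
    [tuple p1.+1; r.+1; p2.+1 * p1.+1]%N.
Proof.
have [v2 v2_neq0 v2E] := exists_root_opp1 p2.+1.
have [v3 v3_neq0 v3E] := exists_root_opp1 r.
apply: (dolgachev_numbers3 (P1 := point3 0 1 v3) (P2 := point3 1 v2 0)
                           (P3 := point3 0 0 1)).
- by split; apply/punctured_zeros3; rewrite !simp3 ?v2E ?v3E ?subrr oner_eq0 ?andbF.
- by rewrite !vanishing3 eqxx oner_eq0 (negPf v2_neq0) (negPf v3_neq0).
- split; [apply: (card_isotropy_hyperplane (i0 := 0) (j := 0)) |
          apply: (card_isotropy_hyperplane (i0 := 2%:R) (j := 2%:R)) | ].
  1-4: move=> [[|[|[|k]]] lt_k3] //.
  1-12: by rewrite mxE ?eqxx ?oner_eq0 ?(negPf v2_neq0) ?(negPf v3_neq0).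
  apply: (card_isotropy_cyclic (k1 := 1) (k2 := p1.+1) (k3 := 0)) => // l1 l2 l3.
  rewrite isotropy_group3 max_group3 !simp3; split.
    move=> [[_ l2_neq0 _ e12 e23] [_ _ l3E]]; rewrite l3E !simp3 in e23.
    exists l1; last by rewrite e12 e23.
    by rewrite mulnC exprM e12 e23; apply: (mulIf l2_neq0); rewrite -exprSr e23 mul1r.
  move=> [t tn [-> -> ->]]; have t0 := unity_root_neq0 tn.
  rewrite !simp3 t0 expf_neq0 //.
  by rewrite oner_eq0 [in _ ^+ p2.+2]exprS -exprM [(p1.+1 * _)%N]mulnC tn !simp3.
move=> x y z; case: (eqVneq x 0) => [-> _ | x0].
  case/punctured_zeros3; rewrite eqxx !simp3 => yz0.
  case: (eqVneq y 0) yz0 => [-> /= z0 _ | y0 _ yz].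
    have [m m0 mE] := exists_root (n := p2.+1) isT (expf_neq0 r.+1 z0).
    have [l l0 lE] := exists_root (n := p1.+1) isT (expf_neq0 p2.+2 m0).
    constructor 3; apply: (group_orbit3 (l := l) (m := m) (n := z)).
    - by apply/max_group3; rewrite !simp3 lE [_ ^+ p2.+2]exprS mE.
    - by rewrite mulr0.
    - by rewrite mulr0.
    - by rewrite mulr1.
  have [||_ z0 {}yz] := @binomial_zero p2 r v3 y z v3E.
    by rewrite (negPf y0).
    by apply: (mulfI y0); rewrite mulr0 mulrDr -exprS.
  have [l l0 lE] := exists_root (n := p1.+1) isT (expf_neq0 p2.+2 y0).
  constructor 1; apply: (group_orbit3 (l := l) (m := y) (n := z / v3)).
  - by apply/max_group3; rewrite !simp3 -yz -exprS.
  - by rewrite mulr0.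
  - by rewrite mulr1.
  - by rewrite divfK.
case: (eqVneq y 0) => [-> _ | y0] /=.
  by case/punctured_zeros3; rewrite !simp3 => _ /eqP; rewrite expf_eq0 (negPf x0).
move=> /eqP->; case/punctured_zeros3; rewrite !simp3 eqxx andbT => xy0.
case/(binomial_zero v2E xy0) => _ y1 xy.
have [l l0 lE] :=
  exists_root (n := r.+1) isT (mulf_neq0 (expf_neq0 p1.+1 x0) (invr_neq0 y1)).
constructor 2; apply: (group_orbit3 (l := x) (m := y / v2) (n := l)).
- by apply/max_group3; rewrite !simp3 lE -xy mulrCA divff ?mulr1.
- by rewrite mulr1.
- by rewrite divfK.
- by rewrite mulr0.
Qed.

(** All zeros on a coordinate plane satisfy x = 0, and the polynomial is then
    y z (y^(q2+1) + z^(q3+1)): one orbit for each of the three factors. *)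
Lemma dolgachev_typeIII p1 q2 q3 :
  dolgachev_numbers R
    (exponent_matrix [:: [:: p1.+1; 0; 0]; [:: 0; q2.+2; 1]; [:: 0; 1; q3.+2]])%N
    [tuple p1.+1; p1.+1 * q2.+1; p1.+1 * q3.+1]%N.
Proof.
have [v v_neq0 vE] := exists_root_opp1 q3.
apply: (dolgachev_numbers3 (P1 := point3 0 1 v) (P2 := point3 0 0 1)
                           (P3 := point3 0 1 0)).
- split; apply/punctured_zeros3; rewrite !simp3 ?oner_eq0 ?andbF //.
  by rewrite [v ^+ q3.+2]exprS vE mulrN1 subrr.
- by rewrite !vanishing3 eqxx oner_eq0 (negPf v_neq0).
- split.
  + apply: (card_isotropy_hyperplane (i0 := 0) (j := 0)) => -[[|[|[|k]]] lt_k3] //;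
    by rewrite mxE ?eqxx ?oner_eq0 ?(negPf v_neq0).
  + apply: (card_isotropy_cyclic (k1 := 1) (k2 := p1.+1) (k3 := 0)) => // l1 l2 l3.
    rewrite isotropy_group3 max_group3 !simp3; split.
      move=> [[_ l2_neq0 _ e12 e23] [_ _ l3E]]; rewrite l3E !simp3 in e12 e23.
      exists l1; last by rewrite e12 e23.
      by rewrite exprM e12 e23; apply: (mulIf l2_neq0); rewrite -exprSr e23 mul1r.
    move=> [t tn [-> -> ->]]; have t0 := unity_root_neq0 tn.
    rewrite !simp3 t0 expf_neq0 //.
    by rewrite oner_eq0 [in _ ^+ q2.+2]exprS -exprM tn !simp3.
  + apply: (card_isotropy_cyclic (k1 := 1) (k2 := 0) (k3 := p1.+1)) => // l1 l2 l3.
    rewrite isotropy_group3 max_group3 !simp3; split.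
      move=> [[_ _ l3_neq0 e12 e23] [_ l2E _]]; rewrite l2E !simp3 in e12 e23.
      exists l1; last by rewrite e12.
      by rewrite exprM e12; apply: (mulIf l3_neq0); rewrite -exprSr -e23 mul1r.
    move=> [t tn [-> -> ->]]; have t0 := unity_root_neq0 tn.
    rewrite !simp3 t0 expf_neq0 //.
    by rewrite oner_eq0 [in _ ^+ q3.+2]exprS -exprM tn !simp3.
move=> x y z; case: (eqVneq x 0) => [-> _ | x0].
  case/punctured_zeros3; rewrite eqxx !simp3 => yz0.
  case: (eqVneq y 0) yz0 => [-> /= z0 _ | y0].
    have [m m0 mE] := exists_root (n := q2.+1) isT (expf_neq0 q3.+1 z0).
    have [l l0 lE] := exists_root (n := p1.+1) isT (mulf_neq0 (expf_neq0 q2.+2 m0) z0).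
    constructor 2; apply: (group_orbit3 (l := l) (m := m) (n := z)).
    - by apply/max_group3; rewrite !simp3 lE [m ^+ _]exprS mE -mulrA -exprSr.
    - by rewrite mulr0.
    - by rewrite mulr0.
    - by rewrite mulr1.
  case: (eqVneq z 0) => [-> /= _ _ | z0 /= _ yz].
    have [n n0 nE] := exists_root (n := q3.+1) isT (expf_neq0 q2.+1 y0).
    have [l l0 lE] := exists_root (n := p1.+1) isT (mulf_neq0 (expf_neq0 q2.+2 y0) n0).
    constructor 3; apply: (group_orbit3 (l := l) (m := y) (n := n)).
    - by apply/max_group3; rewrite !simp3 lE [n ^+ _]exprSr nE mulrA -exprS.
    - by rewrite mulr0.
    - by rewrite mulr1.
    - by rewrite mulr0.
  have [||_ z1 {}yz] := @binomial_zero q2 q3 v y z vE.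
    by rewrite (negPf y0).
    apply: (mulfI (mulf_neq0 y0 z0)); rewrite mulr0 -[RHS]yz.
    by rewrite mulrDr mulrAC -exprS -mulrA -exprS.
  have [l l0 lE] := exists_root (n := p1.+1) isT (mulf_neq0 (expf_neq0 q2.+2 y0) z1).
  constructor 1; apply: (group_orbit3 (l := l) (m := y) (n := z / v)).
  - by apply/max_group3; rewrite !simp3 lE [y ^+ _]exprS yz -!mulrA -exprSr.
  - by rewrite mulr0.
  - by rewrite mulr1.
  - by rewrite divfK.
case: (eqVneq y 0) => [-> _ | y0] /=.
  by case/punctured_zeros3; rewrite !simp3 => _ /eqP; rewrite expf_eq0 (negPf x0).
move=> /eqP->; case/punctured_zeros3; rewrite !simp3 => _ /eqP.
by rewrite expf_eq0 (negPf x0).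
Qed.

(** The polynomial restricts to x (x^(p+1) + y^(a+1)) on z = 0 and to y z^(b+1) on
    x = 0, and has no nonzero zero with y = 0 other than on the z-axis; this leaves an orbit off the axes and the y- and z-axes. *)
Lemma dolgachev_typeIV p a b :
  dolgachev_numbers R
    (exponent_matrix [:: [:: p.+2; 0; 0]; [:: 1; a.+1; 0]; [:: 0; 1; b.+1]])%N
    [tuple b.+1; p.+1 * b.+1; (p.+2 * a).+1]%N.
Proof.
have [v v_neq0 vE] := exists_root_opp1 a.
apply: (dolgachev_numbers3 (P1 := point3 1 v 0) (P2 := point3 0 1 0)
                           (P3 := point3 0 0 1)).
- split; apply/punctured_zeros3; rewrite !simp3 ?oner_eq0 ?andbF //.
  by rewrite vE subrr.
- by rewrite !vanishing3 eqxx oner_eq0 (negPf v_neq0).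
- split.
  + apply: (card_isotropy_hyperplane (i0 := 2%:R) (j := 2%:R)) => -[[|[|[|k]]] lt_k3] //;
    by rewrite mxE ?eqxx ?oner_eq0 ?(negPf v_neq0).
  + apply: (card_isotropy_cyclic (k1 := b.+1) (k2 := 0) (k3 := 1)) => // [|l1 l2 l3].
      by rewrite !inE eqxx !orbT.
    rewrite isotropy_group3 max_group3 !simp3; split.
      move=> [[l1_neq0 _ _ e12 e23] [_ l2E _]]; rewrite l2E !simp3 in e12 e23.
      exists l3; last by rewrite -e23.
      by rewrite mulnC exprM -e23; apply: (mulIf l1_neq0); rewrite -exprSr e12 mul1r.
    move=> [t tn [-> -> ->]]; have t0 := unity_root_neq0 tn.
    rewrite !simp3 t0 expf_neq0 //.
    by rewrite oner_eq0 [in _ ^+ p.+2]exprS -exprM mulnC tn !simp3.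
  + apply: (card_isotropy_cyclic (k1 := 1) (k2 := p.+2) (k3 := 0)) => // l1 l2 l3.
    rewrite isotropy_group3 max_group3 !simp3; split.
      move=> [[_ l2_neq0 _ e12 e23] [_ _ l3E]]; rewrite l3E !simp3 in e12 e23.
      exists l1; last by rewrite e12 e23.
      rewrite exprS exprM e12 e23; apply: (mulIf l2_neq0).
      by rewrite -mulrA -exprSr e23 mul1r.
    move=> [t tn [-> -> ->]]; have t0 := unity_root_neq0 tn.
    rewrite !simp3 t0 expf_neq0 //.
    have -> : t * t ^+ p.+2 ^+ a.+1 = t ^+ p.+2.
      by rewrite [_ ^+ a.+1]exprSr mulrA -exprM -exprS tn mul1r.
    by rewrite oner_eq0.
move=> x y z; case: (eqVneq x 0) => [-> _ | x0].
  case/punctured_zeros3; rewrite eqxx !simp3 => yz0 /eqP.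
  rewrite mulf_eq0 expf_eq0 /= => /orP[] /eqP e0;
    move: yz0; rewrite e0 eqxx ?andbT => /= u0.
    (* Eliminating the second scalar leaves one binomial equation on the first. *)
    have [l l0 lE] :=
      exists_root (n := (p.+2 * a).+1) isT (expf_neq0 a.+1 (expf_neq0 b.+1 u0)).
    constructor 3; apply: (group_orbit3 (l := l) (m := l ^+ p.+2 / z ^+ b.+1) (n := z)).
    - apply/max_group3; rewrite !simp3 u0 l0 mulf_neq0 ?invr_neq0 ?expf_neq0 //.
      rewrite divfK ?expf_neq0 //.
      have -> : l * (l ^+ p.+2 / z ^+ b.+1) ^+ a.+1 = l ^+ p.+2; last by [].
      rewrite exprMn exprVn -lE [in X in _ * (X * _)]exprSr -exprM mulrA mulrA -exprS.
      by rewrite mulrAC divff ?mul1r ?expf_neq0.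
    - by rewrite mulr0.
    - by rewrite mulr0.
    - by rewrite mulr1.
  have [l l0 lE] := exists_root (n := p.+1) isT (expf_neq0 a.+1 u0).
  have [n n0 nE] :=
    exists_root (n := b.+1) isT (mulf_neq0 (expf_neq0 p.+2 l0) (invr_neq0 u0)).
  constructor 2; apply: (group_orbit3 (l := l) (m := y) (n := n)).
  - apply/max_group3; rewrite !simp3 nE mulrCA divff ?mulr1 //.
    by rewrite [l ^+ _]exprS lE.
  - by rewrite mulr0.
  - by rewrite mulr1.
  - by rewrite mulr0.
case: (eqVneq y 0) => [-> _ | y0] /=.
  by case/punctured_zeros3; rewrite !simp3 => _ /eqP; rewrite expf_eq0 (negPf x0).
move=> /eqP->; case/punctured_zeros3; rewrite !simp3 (negPf x0) => _ xy.
have [||_ y1 {}xy] := @binomial_zero p a v x y vE.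
- by rewrite (negPf x0).
- by apply: (mulfI x0); rewrite mulr0 -[RHS]xy mulrDr -exprS.
have [n n0 nE] :=
  exists_root (n := b.+1) isT (mulf_neq0 (expf_neq0 p.+2 x0) (invr_neq0 y1)).
constructor 1; apply: (group_orbit3 (l := x) (m := y / v) (n := n)).
- apply/max_group3; rewrite !simp3 nE mulrCA divff ?mulr1 //.
  by rewrite -xy -exprS.
- by rewrite mulr1.
- by rewrite divfK.
- by rewrite mulr0.
Qed.

(** The isotropy equations of a point on a coordinate axis, in type V: with the
    coordinate of that axis equal to 1, they read b = b^(k+1) c = c^(m+1). *)
Lemma loop_isotropy_eq k m (b c : C) : b != 0 -> b = c ^+ m.+1 ->
  (b = b ^+ k.+1 * c) <-> c ^+ (k * m.+1).+1 = 1.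
Proof.
move=> b0 bE.
have -> : c ^+ (k * m.+1).+1 = b ^+ k * c by rewrite exprSr mulnC exprM -bE.
rewrite [_ ^+ k.+1]exprS -mulrA; split=> [e|->]; last by rewrite mulr1.
by apply: (mulfI b0); rewrite -e mulr1.
Qed.

(** The scalars carrying 1 to x on a coordinate axis, in type V: the equations
    express b by c and x, and c is then a root of a monomial in x. *)
Lemma loop_orbit p k m (x : C) : x != 0 ->
  exists b c, [/\ b != 0, c != 0, x ^+ p.+1 * b = b ^+ k.+1 * c &
                  b ^+ k.+1 * c = c ^+ m.+1 * x].
Proof.
move=> x0.
have xp0 : x ^+ p != 0 by exact: expf_neq0.
have [c c0 cE] := exists_root (n := (m.+1 * k).+1) isT
  (mulf_neq0 (expf_neq0 p.+1 x0) (expf_neq0 k xp0)).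
exists (c ^+ m.+1 / x ^+ p), c.
have e1 : (c ^+ m.+1 / x ^+ p) ^+ k * c = x ^+ p.+1.
  rewrite exprMn exprVn mulrAC -exprM -exprSr cE mulfK //; exact: expf_neq0.
have e2 : (c ^+ m.+1 / x ^+ p) ^+ k.+1 * c = x ^+ p.+1 * (c ^+ m.+1 / x ^+ p).
  by rewrite [_ ^+ k.+1]exprS -mulrA e1 mulrC.
split=> //; first by rewrite mulf_neq0 ?invr_neq0 ?expf_neq0.
by rewrite e2 [x ^+ _]exprS mulrCA -!mulrA mulrCA divff // mulr1 mulrC.
Qed.

(** On each coordinate plane the polynomial is a single monomial in two variables,
    so the zeros there are the axes; cyclic symmetry exchanges them. *)
Lemma dolgachev_typeV q1 q2 q3 :
  dolgachev_numbers R
    (exponent_matrix [:: [:: q1.+1; 1; 0]; [:: 0; q2.+1; 1]; [:: 1; 0; q3.+1]])%N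
    [tuple (q2 * q3.+1).+1; (q3 * q1.+1).+1; (q1 * q2.+1).+1]%N.
Proof.
pose E := exponent_matrix [:: [:: q1.+1; 1; 0]; [:: 0; q2.+1; 1]; [:: 1; 0; q3.+1]]%N.
have orbit1 x : x != 0 -> group_orbit E (point3 1 0 0) (point3 x 0 0).
  move=> x0; have [b [c [b0 c0 e12 e23]]] := loop_orbit q1 q2 q3 x0.
  apply: (group_orbit3 (l := x) (m := b) (n := c)); rewrite ?mulr0 ?mulr1 //.
  by apply/max_group3; rewrite !simp3 [x * _]mulrC.
have orbit2 y : y != 0 -> group_orbit E (point3 0 1 0) (point3 0 y 0).
  move=> y0; have [b [c [b0 c0 e12 e23]]] := loop_orbit q2 q3 q1 y0.
  apply: (group_orbit3 (l := c) (m := y) (n := b)); rewrite ?mulr0 ?mulr1 //.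
  by apply/max_group3; rewrite !simp3 -e23 e12 [c * _]mulrC.
have orbit3 z : z != 0 -> group_orbit E (point3 0 0 1) (point3 0 0 z).
  move=> z0; have [b [c [b0 c0 e12 e23]]] := loop_orbit q3 q1 q2 z0.
  apply: (group_orbit3 (l := b) (m := c) (n := z)); rewrite ?mulr0 ?mulr1 //.
  by apply/max_group3; rewrite !simp3 e23 -[b * _]mulrC e12 e23.
apply: (dolgachev_numbers3 (P1 := point3 1 0 0) (P2 := point3 0 1 0)
                           (P3 := point3 0 0 1)).
- by split; apply/punctured_zeros3; rewrite !simp3 ?oner_eq0 ?andbF.
- by rewrite !vanishing3 eqxx oner_eq0.
- split.
  + apply: (card_isotropy_cyclic (k1 := 0) (k2 := q3.+1) (k3 := 1)) => // [|l1 l2 l3].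
      by rewrite !inE eqxx !orbT.
    rewrite isotropy_group3 max_group3 !simp3; split.
      move=> [[_ l2_neq0 _ e12 e23] [l1E _ _]]; rewrite l1E !simp3 in e12 e23.
      have l2E := etrans e12 e23.
      by exists l3 => //; apply/(loop_isotropy_eq _ l2_neq0 l2E).
    move=> [t tn [-> -> ->]]; have t0 := unity_root_neq0 tn.
    have tm0 : t ^+ q3.+1 != 0 by exact: expf_neq0.
    by move/(loop_isotropy_eq _ tm0 erefl): tn => tE; rewrite !simp3 -tE oner_eq0.
  + apply: (card_isotropy_cyclic (k1 := 1) (k2 := 0) (k3 := q1.+1)) => // l1 l2 l3.
    rewrite isotropy_group3 max_group3 !simp3; split.
      move=> [[_ _ l3_neq0 e12 e23] [_ l2E _]]; rewrite l2E !simp3 in e12 e23.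
      exists l1 => //; apply/(loop_isotropy_eq _ l3_neq0 (esym e12)).
      by rewrite [RHS]mulrC.
    move=> [t tn [-> -> ->]]; have t0 := unity_root_neq0 tn.
    have tm0 : t ^+ q1.+1 != 0 by exact: expf_neq0.
    move/(loop_isotropy_eq _ tm0 erefl): tn => tE.
    by rewrite !simp3 [t * _]mulrC -tE oner_eq0.
  + apply: (card_isotropy_cyclic (k1 := q2.+1) (k2 := 1) (k3 := 0)) => // [|l1 l2 l3].
      by rewrite !inE eqxx !orbT.
    rewrite isotropy_group3 max_group3 !simp3; split.
      move=> [[l1_neq0 _ _ e12 e23] [_ _ l3E]]; rewrite l3E !simp3 in e12 e23.
      exists l2 => //; apply/(loop_isotropy_eq _ l1_neq0 (esym e23)).
      by rewrite e12 e23.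
    move=> [t tn [-> -> ->]]; have t0 := unity_root_neq0 tn.
    have tm0 : t ^+ q2.+1 != 0 by exact: expf_neq0.
    by move/(loop_isotropy_eq _ tm0 erefl): tn => tE; rewrite !simp3 -tE oner_eq0.
move=> x y z xyz0 /punctured_zeros3[]; rewrite !simp3; case/or3P: xyz0 => /eqP->;
  rewrite eqxx ?andbT !simp3 => n0 /eqP; rewrite mulf_eq0 ?expf_eq0 /=;
  case/orP=> /eqP e0; move: n0; rewrite e0 eqxx ?andbT /= => n0.
- by constructor 3; exact: orbit3.
- by constructor 2; exact: orbit2.
- by constructor 3; exact: orbit3.
- by constructor 1; exact: orbit1.
- by constructor 2; exact: orbit2.
- by constructor 1; exact: orbit1.
Qed.
End Types.

(** * Comparing a polynomial with its transpose *)

(** Expanding the product of the a - 1 shows that Delta only depends on the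
    multiset of the entries. *)
Lemma Delta_shift (A : 3.-tuple nat) :
  Delta A = \prod_(a <- A) (a%:Z - 1) - \sum_(a <- A) a%:Z + 1.
Proof.
rewrite !big_tuple !big_ord_recl !big_ord0 /Delta.
have -> : lift ord0 (ord0 : 'I_2) = 1 :> 'I_3 by exact: val_inj.
have -> : lift ord0 (lift ord0 (ord0 : 'I_1)) = 2%:R :> 'I_3 by exact: val_inj.
by ring.
Qed.

Lemma Delta_perm (A B : 3.-tuple nat) : perm_eq A B -> Delta A = Delta B.
Proof. by move=> AB; rewrite !Delta_shift !(perm_big _ AB). Qed.

Lemma Delta3 (a b c : nat) : Delta [tuple a; b; c] =
  a%:Z * b%:Z * c%:Z - b%:Z * c%:Z - a%:Z * c%:Z - a%:Z * b%:Z.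
Proof. by []. Qed.

(** [E'] is meant to be the normal form of the transposed polynomial, for which
    Dolgachev numbers are known; [s] renames the variables and the monomials. *)
Lemma Delta_duality (R : realType) (E E' : 'M[nat]_3) (s : 'S_3)
    (A0 B0 : 3.-tuple nat) :
  dolgachev_numbers R E A0 -> dolgachev_numbers R E' B0 ->
  E^T = row_perm s (col_perm s E') -> Delta A0 = Delta B0 ->
  [/\ exists A : 3.-tuple nat, dolgachev_numbers R E A,
      exists B : 3.-tuple nat, dolgachev_numbers R E^T B
    & forall A B : 3.-tuple nat,
        dolgachev_numbers R E A -> dolgachev_numbers R E^T B ->
        Delta A = Delta B].
Proof.
move=> EA0 /(dolgachev_numbers_perm s s) + E'E eq_Delta; rewrite -E'E => EB0.
split; [by exists A0 | by exists B0 | move=> A B EA EB].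
rewrite (Delta_perm (dolgachev_numbers_uniq EA EA0)) eq_Delta.
exact/esym/Delta_perm/(dolgachev_numbers_uniq EB EB0).
Qed.

Theorem theorem14 (R : realType) (E : 'M[nat]_3) (hE : invertible_type E) :
  [/\ exists A : 3.-tuple nat, dolgachev_numbers R E A,
      exists B : 3.-tuple nat, dolgachev_numbers R E^T B
    & forall A B : 3.-tuple nat,
        dolgachev_numbers R E A -> dolgachev_numbers R E^T B ->
        Delta A = Delta B].
Proof.
case: hE => [p1 p2 p3 | p1 p2 p3 | p1 q2 q3 | p1 p2 p3 | q1 q2 q3].
- case: p1 p2 p3 => [|p1] [|p2] [|p3] // _ _ _.
  apply: (Delta_duality (s := 1%g)
           (dolgachev_typeI R p1 p2 p3)
           (dolgachev_typeI R p1 p2 p3) _ _) => //.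
  by apply/matrixP=> -[[|[|[|i]]] ?] [[|[|[|j]]] ?] //; rewrite !mxE ?perm1.
- case: p1 => // p1 + + _; move: (p3 %/ p2)%N => r.
  case: p2 r => [|[|p2]] [|[|r]] // _ _ _.
  (* Transposition reverses the chain formed by the last two variables. *)
  apply: (Delta_duality (s := tperm 1 2%:R)
           (dolgachev_typeII R p1 p2 r.+1)
           (dolgachev_typeII R p1 r p2.+1) _ _).
    by apply/matrixP=> -[[|[|[|i]]] ?] [[|[|[|j]]] ?] //; rewrite !mxE ?permE.
  by rewrite !Delta3; ring.
- case: p1 q2 q3 => [|[|p1]] [|q2] [|q3] // _ _ _.
  apply: (Delta_duality (s := 1%g)
           (dolgachev_typeIII R p1.+1 q2 q3)
           (dolgachev_typeIII R p1.+1 q2 q3) _ _) => //.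
  by apply/matrixP=> -[[|[|[|i]]] ?] [[|[|[|j]]] ?] //; rewrite !mxE ?perm1.
- move=> + _ + _; move: (p2 %/ p1)%N (p3 %/ p2)%N => a b.
  case: p1 a b => [|[|p1]] [|[|a]] [|[|b]] // _ _ _.
  (* Transposition reverses a chain, so the outer exponents trade places. *)
  apply: (Delta_duality (s := tperm 0 2%:R)
           (dolgachev_typeIV R p1 a.+1 b.+1)
           (dolgachev_typeIV R b a.+1 p1.+1) _ _).
    by apply/matrixP=> -[[|[|[|i]]] ?] [[|[|[|j]]] ?] //; rewrite !mxE ?permE.
  by rewrite !Delta3; ring.
- case: q1 q2 q3 => [|q1] [|q2] [|q3] // _ _ _.
  (* Transposition reverses the loop q1, q2, q3, here read from q1 on. *)
  apply: (Delta_duality (s := tperm 1 2%:R)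
           (dolgachev_typeV R q1 q2 q3)
           (dolgachev_typeV R q1 q3 q2) _ _).
    by apply/matrixP=> -[[|[|[|i]]] ?] [[|[|[|j]]] ?] //; rewrite !mxE ?permE.
  by rewrite !Delta3; ring.
Qed.
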